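(* There exists an effectively inseparable upper pre-semilattice whose pre-ordering relation is not universal.
   Context: $W_u$ denotes the $u$-th c.e. set. A pre-ordering relation is a reflexive transitive relation on $\omega$; it is c.e. if it is c.e. as a set of pairs. A bounded c.e. upper pre-semilattice is a structure $U=\langle\omega,\vee,0,1,\leq_U\rangle$ with $\vee$ a computable binary operation and $\leq_U$ a c.e. pre-ordering relation, such that the equivalence relation $\equiv_U$ ($x\equiv_U y$ iff $x\leq_U y$ and $y\leq_U x$) is a congruence and the quotient $U/{\equiv_U}$, ordered by the partial order induced by $\leq_U$, is an upper semilattice in which $\vee$ induces join, with least element $[0]_U$ and greatest element $[1]_U$ (the $\equiv_U$-classes of $0$ and $1$). A disjoint pair $(A,B)$ of sets is effectively inseparable (e.i.) if there is a partial computable function $\phi(u,v)$ such that whenever $A\subseteq W_u$, $B\subseteq W_v$ and $W_u\cap W_v=\emptyset$, then $\phi(u,v)$ is defined and $\phi(u,v)\notin W_u\cup W_v$. An effectively inseparable upper pre-semilattice is a bounded c.e. upper pre-semilattice $U$ such that the pair $([0]_U,[1]_U)$ is e.i. A c.e. pre-ordering relation $S$ is universal if for every c.e. pre-ordering relation $R$ on $\omega$ there is a computable function $f$ such that for all $x,y$: $x\mathrel{R}y$ iff $f(x)\mathrel{S}f(y)$. *)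

(* Defs.v *)
From Stdlib Require Import Arith RelationClasses.
From Stdlib Require Cantor.

(** * Partial computable functions

    Programs for the unary partial recursive functions on [nat]; functions of
    several arguments are unary functions of Cantor pairs. *)

Notation "<< x , y >>" := (Cantor.to_nat (x, y))
  (at level 0, x at level 99, y at level 99, format "<< x ,  y >>").

Inductive code : Type :=
| Zero
| Succ
| Left
| Right
| Pair (f g : code)
| Comp (f g : code)
| Prec (f g : code)
| Mu (f : code).

(** Graph of the function defined from [F] and [G] by primitive recursion with
    parameter [a]: [h 0 = F a] and [h (n+1) = G <<a, <<n, h n>>>>]. *)
Fixpoint prec_graph (F G : nat -> nat -> Prop) (a n y : nat) : Prop :=
  match n with
  | 0 => F a y
  | S m => exists z, prec_graph F G a m z /\ G <<a, <<m, z>>>> y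
  end.

(** [eval c x y]: the partial function computed by [c] is defined at [x], with
    value [y].  In the case of [Mu f], all the values of [f] before the first
    zero are required to be defined. *)
Fixpoint eval (c : code) (x y : nat) : Prop :=
  match c with
  | Zero => y = 0
  | Succ => y = S x
  | Left => y = fst (Cantor.of_nat x)
  | Right => y = snd (Cantor.of_nat x)
  | Pair f g => exists a b, eval f x a /\ eval g x b /\ y = <<a, b>>
  | Comp f g => exists z, eval g x z /\ eval f z y
  | Prec f g =>
      prec_graph (eval f) (eval g)
        (fst (Cantor.of_nat x)) (snd (Cantor.of_nat x)) y
  | Mu f =>
      eval f <<x, y>> 0 /\ (forall m, m < y -> exists k, eval f <<x, m>> (S k))
  end.

Lemma eval_functional (c : code) (x y z : nat) :
  eval c x y -> eval c x z -> y = z.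
Proof.
  revert x y z.
  induction c as [| | | |f IHf g IHg|f IHf g IHg|f IHf g IHg|f IHf];
    simpl; intros x y z; try congruence.
  - intros (a & b & Ha & Hb & ->) (a' & b' & Ha' & Hb' & ->).
    now rewrite (IHf _ _ _ Ha Ha'), (IHg _ _ _ Hb Hb').
  - intros (a & Ha & Hy) (b & Hb & Hz).
    rewrite (IHg _ _ _ Hb Ha) in Hz. eauto.
  - generalize (fst (Cantor.of_nat x)) as a, (snd (Cantor.of_nat x)) as n.
    intros a n; revert y z; induction n as [|n IHn]; simpl; intros y z; eauto.
    intros (u & Hu & Hy) (v & Hv & Hz).
    rewrite (IHn _ _ Hv Hu) in Hz. eauto.
  - intros [Hy Ly] [Hz Lz].
    destruct (Nat.lt_trichotomy y z) as [H|[H|H]]; trivial.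
    + destruct (Lz _ H) as [k Hk]. discriminate (IHf _ _ _ Hy Hk).
    + destruct (Ly _ H) as [k Hk]. discriminate (IHf _ _ _ Hz Hk).
Qed.

Definition partial_computable2 (phi : nat -> nat -> nat -> Prop) : Prop :=
  exists c, forall u v y, phi u v y <-> eval c <<u, v>> y.

Definition computable (f : nat -> nat) : Prop :=
  exists c, forall x, eval c x (f x).

Definition computable2 (f : nat -> nat -> nat) : Prop :=
  exists c, forall x y, eval c <<x, y>> (f x y).

(** * C.e. sets *)

Fixpoint encode (c : code) : nat :=
  match c with
  | Zero => <<0, 0>>
  | Succ => <<1, 0>>
  | Left => <<2, 0>>
  | Right => <<3, 0>>
  | Pair f g => <<4, <<encode f, encode g>>>>
  | Comp f g => <<5, <<encode f, encode g>>>>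
  | Prec f g => <<6, <<encode f, encode g>>>>
  | Mu f => <<7, encode f>>
  end.

Lemma pair_inj (a b c d : nat) : <<a, b>> = <<c, d>> -> a = c /\ b = d.
Proof. intros H%Cantor.to_nat_inj. now inversion H. Qed.

Lemma encode_inj (c d : code) : encode c = encode d -> c = d.
Proof.
  revert d; induction c; intros []; cbn [encode];
    intros [H1 H2]%pair_inj; try discriminate H1; trivial;
    try apply pair_inj in H2 as [H2 H3]; f_equal; auto.
Qed.

(** The [u]-th c.e. set: the domain of the program with Goedel number [u],
    empty when [u] is not the Goedel number of a program. *)
Definition W (u x : nat) : Prop :=
  exists c, encode c = u /\ exists y, eval c x y.

Definition ce_rel (R : nat -> nat -> Prop) : Prop :=
  exists u, forall x y, R x y <-> W u <<x, y>>.

Definition disjoint (A B : nat -> Prop) : Prop := forall x, ~ (A x /\ B x).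

Definition subset (A B : nat -> Prop) : Prop := forall x, A x -> B x.

Definition effectively_inseparable (A B : nat -> Prop) : Prop :=
  disjoint A B /\
  exists phi, partial_computable2 phi /\
    forall u v, subset A (W u) -> subset B (W v) -> disjoint (W u) (W v) ->
      exists y, phi u v y /\ ~ W u y /\ ~ W v y.

(** * C.e. pre-orderings and upper pre-semilattices *)

Definition ce_preorder (R : nat -> nat -> Prop) : Prop :=
  PreOrder R /\ ce_rel R.

Definition universal (S : nat -> nat -> Prop) : Prop :=
  ce_preorder S /\
  forall R, ce_preorder R ->
    exists f, computable f /\ forall x y, R x y <-> S (f x) (f y).

Definition equiv_of (R : nat -> nat -> Prop) (x y : nat) : Prop :=
  R x y /\ R y x.

(** The order induced on the quotient by [equiv_of le] is [[x] <= [y]] iff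
    [le x y], so the last five fields say, on representatives, that the class
    of [join x y] is the least upper bound of the classes of [x] and [y], and
    that the classes of the numbers [0] and [1] are the least and the greatest
    element. *)
Record upper_presemilattice : Type := {
  join : nat -> nat -> nat;
  le : nat -> nat -> Prop;
  join_computable : computable2 join;
  le_ce_preorder : ce_preorder le;
  join_congruence : forall x x' y y',
    equiv_of le x x' -> equiv_of le y y' ->
    equiv_of le (join x y) (join x' y');
  join_ub_l : forall x y, le x (join x y);
  join_ub_r : forall x y, le y (join x y);
  join_least : forall x y z, le x z -> le y z -> le (join x y) z;
  le_0_least : forall x, le 0 x;
  le_1_greatest : forall x, le x 1
}.

Definition ei_upper_presemilattice (U : upper_presemilattice) : Prop :=
  effectively_inseparable (equiv_of (le U) 0) (equiv_of (le U) 1).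

(* Main.v *)
Require Import Defs.
From Stdlib Require Import Arith Lia List Classical.
From Stdlib Require Cantor.

(** The elements of the semilattice are the finite sets of numbers, coded by
    lists, with union as join.  Two disjoint c.e. sets [A] and [B] determine the
    order: the elements of [A] count for nothing, and a set that meets [B]
    counts as the greatest element.  In other words [x <= y] iff every element
    of [x] is in [A] or in [y], or [y] meets [B] ([le_fin]).  The singleton of
    an element of [A] is then equivalent to the least element, and that of an
    element of [B] to the greatest.

    The quotient consists of the finite subsets of the complement of the union
    of [A] and [B], and a greatest element.  It therefore has no infinite
    descending chain ([no_descending_chain]), whereas the reverse order of
    [nat] is a c.e. preordering; the latter does not reduce to [le_fin].

    For effective inseparability, [A] and [B] diagonalize against all pairs of
    c.e. sets.  The number [a = <<u, v>>] is put in [B] if the singleton [{a}]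
    is found in [W u] at a stage where it is not yet in [W v], and in [A] if it
    is found in [W v] at a stage where it is not yet in [W u].  If [W u] and
    [W v] are disjoint and contain the classes of the least and of the greatest
    element, then [{a}] is in neither: in [W u], it would be equivalent to the
    greatest element, hence also in [W v], and symmetrically ([finset_ei]).

    That [A] and [B] are c.e. uniformly requires an interpreter of programs
    that is itself computable: a stack machine on coded states, correct by
    [run_sound] and [run_complete]. *)

(** * Closure properties of the computable functions *)

Definition car (n : nat) : nat := fst (Cantor.of_nat n).
Definition cdr (n : nat) : nat := snd (Cantor.of_nat n).

Lemma car_pair x y : car <<x, y>> = x.
Proof. unfold car. now rewrite Cantor.cancel_of_to. Qed.

Lemma cdr_pair x y : cdr <<x, y>> = y.
Proof. unfold cdr. now rewrite Cantor.cancel_of_to. Qed.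

Lemma pair_eta n : <<car n, cdr n>> = n.
Proof.
  unfold car, cdr. rewrite <- surjective_pairing. apply Cantor.cancel_to_of.
Qed.

#[local] Opaque Cantor.to_nat Cantor.of_nat.

Ltac pairs := repeat first [rewrite car_pair | rewrite cdr_pair].

Lemma computable_ext f g :
  (forall x, f x = g x) -> computable f -> computable g.
Proof. intros E [c Hc]. exists c. intros x. rewrite <- E. apply Hc. Qed.

Lemma computable_id : computable (fun x => x).
Proof.
  exists (Pair Left Right). intros x. exists (car x), (cdr x).
  repeat split. symmetry; apply pair_eta.
Qed.

Lemma computable_comp f g :
  computable f -> computable g -> computable (fun x => f (g x)).
Proof.
  intros [c Hc] [d Hd]. exists (Comp c d). intros x. exists (g x). auto.
Qed.

Lemma computable_S f : computable f -> computable (fun x => S (f x)).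
Proof. apply (computable_comp S). now exists Succ. Qed.

Lemma computable_car f : computable f -> computable (fun x => car (f x)).
Proof. apply (computable_comp car). now exists Left. Qed.

Lemma computable_cdr f : computable f -> computable (fun x => cdr (f x)).
Proof. apply (computable_comp cdr). now exists Right. Qed.

Lemma computable_const n : computable (fun _ => n).
Proof.
  induction n as [|n IH].
  - now exists Zero.
  - now apply computable_S.
Qed.

Lemma computable_pair f g :
  computable f -> computable g -> computable (fun x => <<f x, g x>>).
Proof.
  intros [c Hc] [d Hd]. exists (Pair c d). intros x. exists (f x), (g x). auto.
Qed.

(** For a binary function, computability is stated on the pair of the
    arguments. *)
Lemma computable_app2 h f g :
  computable (fun p => h (car p) (cdr p)) -> computable f -> computable g ->
  computable (fun x => h (f x) (g x)).
Proof.
  intros Hh Hf Hg.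
  apply computable_ext with (fun x => h (car <<f x, g x>>) (cdr <<f x, g x>>)).
  - intros x. now pairs.
  - apply (computable_comp (fun p => h (car p) (cdr p))); trivial.
    now apply computable_pair.
Qed.

Lemma computable_rec (f : nat -> nat) (g : nat -> nat -> nat -> nat)
  (h : nat -> nat) :
  computable f ->
  computable (fun p => g (car p) (car (cdr p)) (cdr (cdr p))) ->
  computable h ->
  computable (fun x => nat_rect (fun _ => nat) (f x) (g x) (h x)).
Proof.
  intros [c Hc] [d Hd] Hh.
  set (r p := nat_rect (fun _ => nat) (f (car p)) (g (car p)) (cdr p)).
  apply computable_ext with (fun x => r <<x, h x>>).
  { intros x. unfold r. now pairs. }
  apply (computable_comp r);
    [|apply (computable_pair (fun x => x)); [apply computable_id|exact Hh]].
  exists (Prec c d). intros p. unfold r. simpl. fold (car p) (cdr p).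
  generalize (car p) as a, (cdr p) as n. intros a.
  induction n as [|n IH]; simpl; [apply Hc|].
  eexists; split; [exact IH|].
  set (z := nat_rect _ _ _ n). specialize (Hd <<a, <<n, z>>>>).
  revert Hd. now pairs.
Qed.

Lemma computable_case (t a : nat -> nat) (b : nat -> nat -> nat) :
  computable t -> computable a -> computable (fun p => b (car p) (cdr p)) ->
  computable (fun x => match t x with 0 => a x | S m => b x m end).
Proof.
  intros Ht Ha Hb.
  apply computable_ext
    with (fun x => nat_rect (fun _ => nat) (a x) (fun m _ => b x m) (t x)).
  { intros x. now destruct (t x). }
  apply (computable_rec a (fun x m _ => b x m)); trivial.
  apply (computable_app2 b); trivial.
  - apply computable_car, computable_id.
  - apply computable_car, computable_cdr, computable_id.
Qed.

Lemma computable_iter (g : nat -> nat -> nat) (f h : nat -> nat) :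
  computable (fun p => g (car p) (cdr p)) -> computable f -> computable h ->
  computable (fun x => Nat.iter (h x) (g x) (f x)).
Proof.
  intros Hg Hf Hh. apply (computable_rec f (fun x _ z => g x z)); trivial.
  apply (computable_app2 g); trivial.
  - apply computable_car, computable_id.
  - apply computable_cdr, computable_cdr, computable_id.
Qed.

(** [comp] proves [computable] goals by following the syntax of the function;
    the arithmetical operations and the folds over coded lists are added
    below. *)
Ltac comp_step :=
  cbv beta;
  lazymatch goal with
  | |- computable (fun x => x) => apply computable_id
  | |- computable S => apply (computable_S (fun x => x))
  | |- computable car => apply (computable_car (fun x => x))
  | |- computable cdr => apply (computable_cdr (fun x => x))
  | |- computable (fun _ => ?n) => apply (computable_const n)
  | |- computable (fun x => S (@?F x)) => apply (computable_S F)
  | |- computable (fun x => car (@?F x)) => apply (computable_car F)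
  | |- computable (fun x => cdr (@?F x)) => apply (computable_cdr F)
  | |- computable (fun x => Cantor.to_nat (@?F x, @?G x)) =>
      apply (computable_pair F G)
  | |- computable (fun x => match @?T x with 0 => @?A x | S m => @?B x m end) =>
      apply (computable_case T A B)
  | |- computable (fun x => Nat.iter (@?H x) (@?G x) (@?F x)) =>
      apply (computable_iter G F H)
  | |- computable (fun x => nat_rect _ (@?F x) (@?G x) (@?H x)) =>
      apply (computable_rec F G H)
  end.
Ltac comp := repeat comp_step.

Lemma computable_add f g :
  computable f -> computable g -> computable (fun x => f x + g x).
Proof.
  apply computable_app2.
  apply computable_ext with (fun p => Nat.iter (car p) S (cdr p)).
  - intros p. induction (car p); simpl; congruence.
  - comp.
Qed.

Lemma computable_mul f g :
  computable f -> computable g -> computable (fun x => f x * g x).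
Proof.
  apply computable_app2.
  apply computable_ext with (fun p => Nat.iter (car p) (fun z => cdr p + z) 0).
  - intros p. induction (car p); simpl; congruence.
  - comp. apply computable_add; comp.
Qed.

Lemma computable_sub f g :
  computable f -> computable g -> computable (fun x => f x - g x).
Proof.
  apply computable_app2.
  apply computable_ext
    with (fun p => Nat.iter (cdr p)
                     (fun z => match z with 0 => 0 | S m => m end) (car p)).
  - intros p. induction (cdr p) as [|n IH]; simpl; [lia|].
    rewrite IH. destruct (car p - n) eqn:E; lia.
  - comp.
Qed.

(** * A stack machine for programs *)

(** Lists of numbers are coded with [0] as the empty list. *)
Definition ccons (a l : nat) : nat := S <<a, l>>.

(** A state of the machine is a pair of a stack of instructions and a current
    value; the machine has halted when the stack is empty.  [exec t w k x] is
    the state after executing the instruction [<<t, w>>] on the value [x], with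
    [k] the rest of the stack.  The instructions with [t < 8] are the Goedel
    numbers of programs: such an instruction replaces the current value by the
    value of the program at it.  The others are continuations:
    - [<<8, <<g, x>>>>]: the current value is that of the first component of a
      pair at [x]; run [g] at [x];
    - [<<11, a>>]: pair [a] with the current value;
    - [<<9, <<g, <<a, m>>>>>>]: the current value is that of a primitive
      recursion at [m], with parameter [a]; do the step from [m] to [S m] with
      [g];
    - [<<10, <<f, <<x, y>>>>>>]: the current value is that of [f] at
      [<<x, y>>], in a search for the least zero; return [y] or try [S y]. *)
Definition exec (t w k x : nat) : nat :=
  match t with
  | 0 => <<k, 0>>
  | 1 => <<k, S x>>
  | 2 => <<k, car x>>
  | 3 => <<k, cdr x>>
  | 4 => <<ccons (car w) (ccons <<8, <<cdr w, x>>>> k), x>>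
  | 5 => <<ccons (cdr w) (ccons (car w) k), x>>
  | 6 => match cdr x with
         | 0 => <<ccons (car w) k, car x>>
         | S m => <<ccons <<6, w>> (ccons <<9, <<cdr w, <<car x, m>>>>>> k),
                    <<car x, m>>>>
         end
  | 7 => <<ccons w (ccons <<10, <<w, <<x, 0>>>>>> k), <<x, 0>>>>
  | 8 => <<ccons (car w) (ccons <<11, x>> k), cdr w>>
  | 9 => <<ccons (car w) k, <<car (cdr w), <<cdr (cdr w), x>>>>>>
  | 10 => match x with
          | 0 => <<k, cdr (cdr w)>>
          | S _ => <<ccons (car w)
                       (ccons <<10, <<car w, <<car (cdr w), S (cdr (cdr w))>>>>>> k),
                     <<car (cdr w), S (cdr (cdr w))>>>>
          end
  | _ => <<k, <<w, x>>>>
  end.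

Definition step (s : nat) : nat :=
  match car s with
  | 0 => s
  | S q => exec (car (car q)) (cdr (car q)) (cdr q) (cdr s)
  end.

Lemma computable_step : computable step.
Proof. unfold step, exec, ccons. comp. Qed.

Lemma computable_app3 g f1 f2 f3 :
  computable (fun p => g (car p) (car (cdr p)) (cdr (cdr p))) ->
  computable f1 -> computable f2 -> computable f3 ->
  computable (fun x => g (f1 x) (f2 x) (f3 x)).
Proof.
  intros Hg H1 H2 H3.
  apply (computable_ext (fun x =>
    (fun p => g (car p) (car (cdr p)) (cdr (cdr p))) <<f1 x, <<f2 x, f3 x>>>>)).
  - intros x. now pairs.
  - now apply (computable_comp _ _ Hg); repeat apply computable_pair.
Qed.

(** A halted state is a fixed point of [step], so this says that the machine
    halts from [s] after at most [n] steps. *)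
Definition halts_in (n s : nat) : Prop := car (Nat.iter n step s) = 0.

Lemma step_cons t w k x : step <<ccons <<t, w>> k, x>> = exec t w k x.
Proof. unfold step, ccons. now pairs. Qed.

Lemma halts_in_cons n t w k x :
  halts_in n <<ccons <<t, w>> k, x>> ->
  exists m, n = S m /\ halts_in m (exec t w k x).
Proof.
  destruct n as [|n]; unfold halts_in.
  - simpl. pairs. discriminate.
  - rewrite Nat.iter_succ_r, step_cons. eauto.
Qed.

Lemma cons_halts t w k x :
  (exists n, halts_in n (exec t w k x)) ->
  exists n, halts_in n <<ccons <<t, w>> k, x>>.
Proof.
  intros [n H]. exists (S n). unfold halts_in.
  now rewrite Nat.iter_succ_r, step_cons.
Qed.

Lemma halts_in_le m n s : m <= n -> halts_in m s -> halts_in n s.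
Proof.
  unfold halts_in. induction 1 as [|n _ IH]; simpl; trivial.
  intros H. unfold step at 1. now rewrite (IH H), (IH H).
Qed.

(** Executes the instruction on top of the stack in the hypothesis [H]. *)
Ltac pop H :=
  cbn [encode] in H; apply halts_in_cons in H as (? & -> & H);
  cbn [exec] in H; revert H; pairs; intros H.

(** The bound [m < n] is what the induction over the successive attempts of a
    [Mu] search needs. *)
Lemma run_sound c n k x :
  halts_in n <<ccons (encode c) k, x>> ->
  exists y m, m < n /\ eval c x y /\ halts_in m <<k, y>>.
Proof.
  revert n k x.
  induction c as [| | | |f IHf g IHg|f IHf g IHg|f IHf g IHg|f IHf];
    intros n k x H.
  - pop H. eexists _, _. repeat split; [|exact H]. lia.
  - pop H. eexists _, _. repeat split; [|exact H]. lia.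
  - pop H. eexists _, _. repeat split; [|exact H]. lia.
  - pop H. eexists _, _. repeat split; [|exact H]. lia.
  - pop H. apply IHf in H as (a & m & Hm & Ha & H).
    pop H. apply IHg in H as (b & m' & Hm' & Hb & H).
    pop H. eexists _, _. repeat split; [|now exists a, b|exact H]. lia.
  - pop H. apply IHg in H as (a & m & Hm & Ha & H).
    apply IHf in H as (b & m' & Hm' & Hb & H).
    exists b, m'. repeat split; [lia|now exists a|exact H].
  - rewrite <- (pair_eta x) in *. revert H.
    generalize (car x) as a, (cdr x) as i. intros a i.
    enough (forall n k, halts_in n <<ccons (encode (Prec f g)) k, <<a, i>>>> ->
      exists y m, m < n /\ prec_graph (eval f) (eval g) a i y /\
                  halts_in m <<k, y>>) as Hi.
    { intros H. destruct (Hi _ _ H) as (y & m & ? & ? & ?). exists y, m.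
      simpl. fold (car <<a, i>>) (cdr <<a, i>>). now pairs. }
    clear n k x. induction i as [|i IHi]; intros n k H; pop H.
    + apply IHf in H as (y & m & ? & ? & ?). exists y, m.
      repeat split; trivial; lia.
    + apply IHi in H as (z & m & ? & ? & H). pop H.
      apply IHg in H as (y & m' & ? & ? & ?). exists y, m'.
      repeat split; trivial; [lia|]. simpl. eauto.
  - apply halts_in_cons in H as (p & -> & H). cbn [exec] in H.
    (* Generalized to the stage where the values of [f] before [y] have been
       found to be nonzero. *)
    enough (forall n y,
      halts_in n
        <<ccons (encode f) (ccons <<10, <<encode f, <<x, y>>>>>> k), <<x, y>>>> ->
      (forall j, j < y -> exists i, eval f <<x, j>> (S i)) ->
      exists y' m, m < n /\ eval (Mu f) x y' /\ halts_in m <<k, y'>>) as Hy.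
    { destruct (Hy _ _ H) as (y & m & Hm & Hev & Hh); [lia|].
      exists y, m. split; [lia|now split]. }
    clear p H. intros n. induction n as [n IHn] using lt_wf_ind.
    intros y H Hlt. apply IHf in H as (z & m & Hm & Hz & H).
    apply halts_in_cons in H as (p & -> & H). cbn [exec] in H.
    revert H. pairs. intros H. destruct z as [|z].
    + exists y, p. repeat split; trivial. lia.
    + apply IHn in H as (y' & m & Hm' & Hev & Hh); [|lia|].
      * exists y', m. split; [lia|now split].
      * intros j Hj. destruct (Nat.eq_dec j y) as [->|]; eauto.
        apply Hlt. lia.
Qed.

(** Executes the instruction on top of the stack in the goal. *)
Ltac push := cbn [encode]; apply cons_halts; cbn [exec]; pairs.

Lemma run_complete c k x y :
  eval c x y -> (exists n, halts_in n <<k, y>>) ->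
  exists n, halts_in n <<ccons (encode c) k, x>>.
Proof.
  revert k x y.
  induction c as [| | | |f IHf g IHg|f IHf g IHg|f IHf g IHg|f IHf];
    intros k x y H Hk.
  - push. now simpl in H; subst.
  - push. now simpl in H; subst.
  - push. now simpl in H; subst.
  - push. now simpl in H; subst.
  - destruct H as (a & b & Ha & Hb & ->). push.
    apply (IHf _ _ _ Ha). push. apply (IHg _ _ _ Hb). now push.
  - destruct H as (a & Ha & Hb). push. eauto.
  - rewrite <- (pair_eta x). simpl in H. fold (car x) (cdr x) in H.
    revert H. generalize (car x) as a, (cdr x) as i. intros a i H.
    revert k y H Hk.
    induction i as [|i IHi]; intros k y H Hk; push.
    + eauto.
    + destruct H as (z & Hz & H). apply (IHi _ _ Hz). push. eauto.
  - destruct H as [Hy Hlt]. push.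
    enough (forall d, d <= y -> exists n, halts_in n
      <<ccons (encode f) (ccons <<10, <<encode f, <<x, y - d>>>>>> k),
        <<x, y - d>>>>) as Hd.
    { specialize (Hd y). rewrite Nat.sub_diag in Hd. auto. }
    induction d as [|d IHd]; intros Hd.
    + rewrite Nat.sub_0_r. apply (IHf _ _ _ Hy). now push.
    + destruct (Hlt (y - S d)) as [i Hi]; [lia|].
      apply (IHf _ _ _ Hi). push.
      replace (S (y - S d)) with (y - d) by lia. apply IHd. lia.
Qed.

(** [run e x s] is [0] iff the machine, started on the program with Goedel
    number [e] at [x], has halted after [s] steps. *)
Definition run (e x s : nat) : nat := car (Nat.iter s step <<ccons e 0, x>>).

(** For a number [e] that is not the Goedel number of a program, [W e] is empty,
    but the machine may halt on [e]. *)
Lemma W_run c x : W (encode c) x <-> exists s, run (encode c) x s = 0.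
Proof.
  split.
  - intros (d & E & y & H). apply encode_inj in E as ->.
    apply (run_complete c 0 x y H). exists 0. unfold halts_in. simpl. now pairs.
  - intros [s H]. apply run_sound in H as (y & _ & _ & H & _). now exists c; eauto.
Qed.

(** * Finite sets of numbers, as coded lists *)

Fixpoint enc_list (l : list nat) : nat :=
  match l with
  | nil => 0
  | a :: l => ccons a (enc_list l)
  end%list.

Lemma pair_ge_r a b : b <= <<a, b>>.
Proof. pose proof (Cantor.to_nat_non_decreasing a b). lia. Qed.

Lemma enc_list_surj n : exists l, enc_list l = n.
Proof.
  induction n as [[|n] IH] using lt_wf_ind.
  - now exists nil.
  - destruct (IH (cdr n)) as [l Hl].
    + pose proof (pair_ge_r (car n) (cdr n)) as H. rewrite pair_eta in H. lia.
    + exists (car n :: l)%list. simpl. unfold ccons. now rewrite Hl, pair_eta.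
Qed.

Lemma enc_list_inj l l' : enc_list l = enc_list l' -> l = l'.
Proof.
  revert l'.
  induction l as [|a l IH]; intros [|a' l']; simpl; try discriminate; trivial.
  intros [-> H]%Nat.succ_inj%pair_inj. f_equal. auto.
Qed.

(** Membership in the finite set with code [n]. *)
Definition elem (a n : nat) : Prop := exists l, enc_list l = n /\ In a l.

Lemma elem_enc_list a l : elem a (enc_list l) <-> In a l.
Proof.
  split.
  - now intros (l' & ->%enc_list_inj & H).
  - now exists l.
Qed.

Lemma elem_0 a : ~ elem a 0.
Proof. exact (proj1 (elem_enc_list a nil)). Qed.

Lemma elem_cons a b n : elem a (ccons b n) <-> a = b \/ elem a n.
Proof.
  destruct (enc_list_surj n) as [l <-].
  rewrite (elem_enc_list a (b :: l)), elem_enc_list. simpl. intuition.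
Qed.

(** Left fold over the list with code [n].  The code is also the number of
    iterations: it is at least the length of the list. *)
Definition foldc (g : nat -> nat -> nat) (i n : nat) : nat :=
  cdr (Nat.iter n
    (fun s => match car s with
              | 0 => s
              | S q => <<cdr q, g (car q) (cdr s)>>
              end) <<n, i>>).

Lemma foldc_enc_list g i l :
  foldc g i (enc_list l) = fold_left (fun r a => g a r) l i.
Proof.
  unfold foldc. set (st := fun s : nat => _).
  enough (forall n, enc_list l <= n ->
    Nat.iter n st <<enc_list l, i>> = <<0, fold_left (fun r a => g a r) l i>>)
    as H.
  { rewrite H; trivial. now pairs. }
  revert i. induction l as [|a l IH]; simpl; intros i n Hn.
  - clear Hn. induction n as [|n IH]; simpl; trivial.
    rewrite IH. unfold st. now pairs.
  - unfold ccons in *. pose proof (pair_ge_r a (enc_list l)).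
    destruct n as [|n]; [lia|]. rewrite Nat.iter_succ_r.
    unfold st at 2. pairs. apply IH. lia.
Qed.

Lemma computable_foldc g i n :
  computable (fun p => g (car p) (car (cdr p)) (cdr (cdr p))) ->
  computable i -> computable n ->
  computable (fun x => foldc (g x) (i x) (n x)).
Proof.
  intros Hg Hi Hn. unfold foldc. comp; trivial.
  apply (computable_app3 g); comp; trivial.
Qed.

(** In decision procedures [0] stands for truth, so that conjunction is addition
    and disjunction is multiplication. *)
Lemma foldc_forall P n :
  foldc (fun a r => P a + r) 0 n = 0 <-> forall a, elem a n -> P a = 0.
Proof.
  destruct (enc_list_surj n) as [l <-]. rewrite foldc_enc_list.
  setoid_rewrite elem_enc_list.
  enough (forall i, fold_left (fun r a => P a + r) l i = 0 <->
                    i = 0 /\ forall a, In a l -> P a = 0) as H.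
  { rewrite H. intuition. }
  induction l as [|b l IH]; intros i; simpl; [intuition|].
  rewrite IH. split.
  - intros [H H']. split; [lia|]. intros a [->|Ha]; [lia|auto].
  - intros [-> H]. split; [|auto]. rewrite (H b); auto.
Qed.

Lemma foldc_exists P n :
  foldc (fun a r => P a * r) 1 n = 0 <-> exists a, elem a n /\ P a = 0.
Proof.
  destruct (enc_list_surj n) as [l <-]. rewrite foldc_enc_list.
  setoid_rewrite elem_enc_list.
  enough (forall i, fold_left (fun r a => P a * r) l i = 0 <->
                    i = 0 \/ exists a, In a l /\ P a = 0) as H.
  { rewrite H. intuition discriminate. }
  induction l as [|b l IH]; intros i; simpl; [firstorder|].
  rewrite IH, Nat.eq_mul_0. split.
  - intros [[H|H]|(a & Ha & H)]; eauto.
  - intros [H|(a & [->|Ha] & H)]; eauto.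
Qed.

Definition mem (a n : nat) : nat :=
  foldc (fun b r => (a - b + (b - a)) * r) 1 n.

Lemma mem_spec a n : mem a n = 0 <-> elem a n.
Proof.
  unfold mem. rewrite foldc_exists. split.
  - intros (b & Hb & H). now replace a with b by lia.
  - intros H. exists a. split; trivial. lia.
Qed.

Ltac comp_arith :=
  comp_step ||
  lazymatch goal with
  | |- computable (fun x => @?F x + @?G x) => apply (computable_add F G)
  | |- computable (fun x => @?F x * @?G x) => apply (computable_mul F G)
  | |- computable (fun x => @?F x - @?G x) => apply (computable_sub F G)
  | |- computable (fun x => foldc (@?G x) (@?I x) (@?N x)) =>
      apply (computable_foldc G I N)
  end.
Ltac comp ::= repeat comp_arith.

(** Union of finite sets. *)
Definition append (x y : nat) : nat := foldc ccons y x.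

Lemma append_computable : computable2 append.
Proof.
  enough (computable (fun p => append (car p) (cdr p))) as [c Hc].
  { exists c. intros x y. specialize (Hc <<x, y>>). revert Hc. now pairs. }
  unfold append, ccons. comp.
Qed.

Lemma elem_append a x y : elem a (append x y) <-> elem a x \/ elem a y.
Proof.
  unfold append. destruct (enc_list_surj x) as [l <-].
  rewrite foldc_enc_list, elem_enc_list. revert y.
  induction l as [|b l IH]; intros y; simpl; [tauto|].
  rewrite IH, elem_cons. intuition.
Qed.

(** * A pair of c.e. sets diagonalizing against all pairs *)

(** [halts_first u v x s] is [0] iff at some stage before [s] the program [u]
    has halted at [x] and [v] has not.  The bounded search makes this monotone
    in [s]. *)
Definition halts_first (u v x s : nat) : nat :=
  nat_rect (fun _ => nat) 1 (fun t r => (run u x t + (1 - run v x t)) * r) s.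

Lemma halts_first_spec u v x s :
  halts_first u v x s = 0 <->
  exists t, t < s /\ run u x t = 0 /\ run v x t <> 0.
Proof.
  induction s as [|s IH].
  - split; [discriminate|]. intros (t & H & _). lia.
  - change (halts_first u v x (S s))
      with ((run u x s + (1 - run v x s)) * halts_first u v x s).
    rewrite Nat.eq_mul_0, IH. split.
    + intros [H|(t & Ht & H)].
      * exists s. lia.
      * exists t. auto.
    + intros (t & Ht & H). destruct (Nat.eq_dec t s) as [->|].
      * left. lia.
      * right. exists t. split; [lia|auto].
Qed.

(** The code of the singleton of [a]. *)
Definition single (a : nat) : nat := ccons a 0.

(** Stage [s] of the enumeration of [A] and [B].  The factor [b] puts [0] in [B],
    because the number [1], which has to be the greatest element, is the code of
    the singleton of [0]. *)
Definition stageA (a s : nat) : nat := halts_first (cdr a) (car a) (single a) s.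
Definition stageB (b s : nat) : nat :=
  b * halts_first (car b) (cdr b) (single b) s.
Definition A (a : nat) : Prop := exists s, stageA a s = 0.
Definition B (b : nat) : Prop := exists s, stageB b s = 0.

Lemma stageA_le a s s' : s <= s' -> stageA a s = 0 -> stageA a s' = 0.
Proof.
  unfold stageA. rewrite !halts_first_spec. intros Hs (t & Ht & H).
  exists t. split; trivial. lia.
Qed.

Lemma run_le e x s t : s <= t -> run e x s = 0 -> run e x t = 0.
Proof. apply halts_in_le. Qed.

Lemma halts_first_disjoint u v x s t :
  halts_first u v x s = 0 -> halts_first v u x t = 0 -> False.
Proof.
  rewrite !halts_first_spec. intros (i & _ & Hu & Hv) (j & _ & Hv' & Hu').
  destruct (Nat.le_ge_cases i j) as [H|H].
  - apply Hu'. now apply run_le with i.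
  - apply Hv. now apply run_le with j.
Qed.

Lemma pair_0 : <<0, 0>> = 0.
Proof. reflexivity. Qed.

Lemma AB_disjoint a : A a -> B a -> False.
Proof.
  intros [s HA] [t HB]. unfold stageA, stageB in *.
  apply Nat.eq_mul_0 in HB as [->|HB].
  - (* The two components of [0] are the same, so neither program halts first. *)
    enough (car 0 = cdr 0) as E.
    { rewrite E in HA. exact (halts_first_disjoint _ _ _ _ _ HA HA). }
    rewrite <- pair_0. now pairs.
  - exact (halts_first_disjoint _ _ _ _ _ HA HB).
Qed.

(** * The semilattice of finite sets *)

(** The elements of [A] are neglected, and a set that meets [B] is a greatest
    element. *)
Definition le_fin (x y : nat) : Prop :=
  (forall a, elem a x -> A a \/ elem a y) \/ exists b, elem b y /\ B b.

Lemma le_fin_refl x : le_fin x x.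
Proof. left. auto. Qed.

Lemma le_fin_trans x y z : le_fin x y -> le_fin y z -> le_fin x z.
Proof.
  intros [Hxy|(b & Hb & HB)] [Hyz|?]; try (right; assumption).
  - left. intros a Ha. destruct (Hxy a Ha); auto.
  - destruct (Hyz b Hb) as [HA|Hz].
    + destruct (AB_disjoint b HA HB).
    + right. eauto.
Qed.

(** [check x y s] is [0] iff [le_fin x y] is established by stage [s]. *)
Definition check (x y s : nat) : nat :=
  foldc (fun a r => stageA a s * mem a y + r) 0 x *
  foldc (fun b r => stageB b s * r) 1 y.

Lemma check_spec x y : le_fin x y <-> exists s, check x y s = 0.
Proof.
  unfold le_fin, check. setoid_rewrite Nat.eq_mul_0.
  setoid_rewrite foldc_forall. setoid_rewrite foldc_exists. split.
  - intros [H|(b & Hb & s & HB)]; [|now eauto].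
    enough (exists s, forall a, elem a x -> stageA a s * mem a y = 0)
      as [s Hs] by eauto.
    revert H. destruct (enc_list_surj x) as [l <-]. setoid_rewrite elem_enc_list.
    induction l as [|a l IH]; intros H.
    + now exists 0.
    + destruct IH as [s Hs]; [intros a' Ha'; apply H; now right|].
      destruct (H a) as [[s' HA]|Ha]; [now left| |].
      * exists (s + s'). intros a' [<-|Ha'].
        -- now rewrite (stageA_le a s' (s + s')) by (trivial; lia).
        -- specialize (Hs a' Ha'). apply Nat.eq_mul_0 in Hs as [Hs|Hs]; [|lia].
           now rewrite (stageA_le a' s (s + s')) by (trivial; lia).
      * exists s. intros a' [<-|Ha']; [|auto].
        apply mem_spec in Ha. lia.
  - intros (s & [H|(b & Hb & HB)]).
    + left. intros a Ha. specialize (H a Ha).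
      apply Nat.eq_mul_0 in H as [H|H]; [left; now exists s|right].
      now apply mem_spec.
    + right. exists b. split; trivial. now exists s.
Qed.

Lemma ce_rel_search (f : nat -> nat -> nat -> nat) (R : nat -> nat -> Prop) :
  computable (fun p => f (car (car p)) (cdr (car p)) (cdr p)) ->
  (forall x y, R x y <-> exists s, f x y s = 0) -> ce_rel R.
Proof.
  intros [c Hc] HR. exists (encode (Mu c)). intros x y. rewrite HR.
  assert (forall s, eval c <<<<x, y>>, s>> (f x y s)) as Hf.
  { intros s. specialize (Hc <<<<x, y>>, s>>). revert Hc. now pairs. }
  split.
  - intros [s Hs]. exists (Mu c). split; trivial.
    induction s as [s IH] using lt_wf_ind.
    destruct (classic (exists m, m < s /\ f x y m = 0)) as [(m & Hm & H)|H].
    + exact (IH m Hm H).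
    + exists s. split; [rewrite <- Hs; apply Hf|].
      intros m Hm. exists (pred (f x y m)). rewrite Nat.succ_pred; auto.
      intros E. apply H. eauto.
  - intros (d & ->%encode_inj & s & Hs & _).
    exists s. eapply eval_functional; eauto.
Qed.

Lemma run_computable :
  computable (fun p => run (car p) (car (cdr p)) (cdr (cdr p))).
Proof.
  unfold run, ccons. comp. apply (computable_comp step); comp.
  apply computable_step.
Qed.

Lemma le_fin_ce : ce_rel le_fin.
Proof.
  apply ce_rel_search with check; [|exact check_spec].
  unfold check, stageA, stageB, halts_first, mem, single, ccons. comp;
  apply (computable_app3 run); try apply run_computable; comp.
Qed.

Lemma le_fin_0 x : le_fin 0 x.
Proof. left. now intros a Ha%elem_0. Qed.

Lemma one_single : 1 = single 0.
Proof. unfold single, ccons. now rewrite pair_0. Qed.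

Lemma le_fin_1 x : le_fin x 1.
Proof.
  right. exists 0. split.
  - rewrite one_single. apply elem_cons. auto.
  - now exists 0.
Qed.

Lemma append_least x y z : le_fin x z -> le_fin y z -> le_fin (append x y) z.
Proof.
  intros [Hx|H] [Hy|H']; try (right; assumption).
  left. intros a [Ha|Ha]%elem_append; auto.
Qed.

Lemma append_ub_l x y : le_fin x (append x y).
Proof. left. intros a Ha. right. apply elem_append. auto. Qed.

Lemma append_ub_r x y : le_fin y (append x y).
Proof. left. intros a Ha. right. apply elem_append. auto. Qed.

Definition finset_presemilattice : upper_presemilattice.
Proof.
  refine {| join := append; le := le_fin |}.
  - exact append_computable.
  - split; [split; [exact le_fin_refl|exact le_fin_trans]|exact le_fin_ce].
  - enough (forall x x' y y', le_fin x x' -> le_fin y y' ->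
                              le_fin (append x y) (append x' y')) as H.
    { intros x x' y y' [H1 H2] [H3 H4]. split; auto. }
    intros x x' y y' Hx Hy. apply append_least.
    + eapply le_fin_trans; [exact Hx|apply append_ub_l].
    + eapply le_fin_trans; [exact Hy|apply append_ub_r].
  - exact append_ub_l.
  - exact append_ub_r.
  - exact append_least.
  - exact le_fin_0.
  - exact le_fin_1.
Defined.

Lemma le_fin_1_0 : ~ le_fin 1 0.
Proof.
  rewrite one_single. intros [H|(b & Hb & _)].
  - destruct (H 0) as [H0|H0].
    + apply elem_cons. auto.
    + apply (AB_disjoint 0); trivial. now exists 0.
    + exact (elem_0 _ H0).
  - exact (elem_0 _ Hb).
Qed.

Lemma A_single a : A a -> equiv_of le_fin 0 (single a).
Proof.
  intros HA. split; [apply le_fin_0|].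
  left. intros b [->|Hb]%elem_cons; [auto|destruct (elem_0 _ Hb)].
Qed.

Lemma B_single b : B b -> equiv_of le_fin 1 (single b).
Proof.
  intros HB. split; [|apply le_fin_1].
  right. exists b. split; trivial. apply elem_cons. auto.
Qed.

(** As [W v] is nonempty, [v] is a Goedel number, so the machine does not halt
    on [v] at [x]. *)
Lemma halts_first_separate u v x :
  W u x -> ~ W v x -> (exists y, W v y) -> exists s, halts_first u v x s = 0.
Proof.
  intros (c & <- & Hc) Hv (y & d & <- & _).
  destruct (proj1 (W_run c x)) as [s Hs]; [now exists c|].
  exists (S s). apply halts_first_spec. exists s. repeat split; auto.
  intros E. apply Hv, W_run. eauto.
Qed.

Lemma finset_ei : ei_upper_presemilattice finset_presemilattice.
Proof.
  split.
  - intros x [[_ H] [H' _]]. apply le_fin_1_0. eapply le_fin_trans; eauto.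
  - exists (fun u v y => y = single <<u, v>>). split.
    + assert (computable single) as [c Hc] by (unfold single, ccons; comp).
      exists c. intros u v y. split.
      * intros ->. apply Hc.
      * intros H. eapply eval_functional; eauto.
    + intros u v Hu Hv Huv. set (a := <<u, v>>). exists (single a).
      split; [reflexivity|].
      assert (W u 0) as Hu0 by (apply Hu; split; apply le_fin_refl).
      assert (W v 1) as Hv1 by (apply Hv; split; apply le_fin_refl).
      split; intros H.
      * assert (~ W v (single a)) as H' by (intros H'; exact (Huv _ (conj H H'))).
        apply H', Hv, B_single.
        destruct (halts_first_separate u v (single a)) as [s Hs]; eauto.
        exists s. unfold stageB, a in *. pairs. rewrite Hs. lia.
      * assert (~ W u (single a)) as H' by (intros H'; exact (Huv _ (conj H' H))).
        apply H', Hu, A_single.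
        destruct (halts_first_separate v u (single a)) as [s Hs]; eauto.
        exists s. unfold stageA, a in *. now pairs.
Qed.

(** * No infinite descending chain *)

Lemma ge_ce_preorder : ce_preorder (fun x y => y <= x).
Proof.
  split.
  - split; intros x; intros; lia.
  - apply ce_rel_search with (fun x y _ => y - x); [comp|].
    intros x y. split.
    + intros H. exists 0. lia.
    + intros [_ H]. lia.
Qed.

Lemma no_descending_chain (f : nat -> nat) :
  ~ forall x y, y <= x <-> le_fin (f x) (f y).
Proof.
  intros Hf.
  (* Only [f 0] can be the greatest element. *)
  assert (forall n b, elem b (f (S n)) -> ~ B b) as HB.
  { intros n b Hb HB. enough (S n <= n) by lia.
    apply Hf. right. eauto. }
  (* [f (S n)] minus [A] strictly decreases, so a list [l] that covers it can be
     shortened at each step. *)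
  enough (forall k n l, length l <= k ->
    ~ forall a, elem a (f (S n)) -> A a \/ In a l) as H.
  { destruct (enc_list_surj (f 1)) as [l E].
    apply (H (length l) 0 l); trivial.
    intros a. rewrite <- E, elem_enc_list. auto. }
  intros k. induction k as [k IH] using lt_wf_ind. intros n l Hl H.
  assert (exists a, elem a (f (S n)) /\ ~ A a /\ ~ elem a (f (S (S n))))
    as (a & Ha & HA & Ha').
  { apply NNPP. intros Hn. enough (S (S n) <= S n) by lia.
    apply Hf. left. intros a Ha.
    destruct (classic (A a)), (classic (elem a (f (S (S n))))); auto.
    exfalso. eauto. }
  destruct (H a Ha) as [|Hal]; [contradiction|].
  apply (IH (length (remove Nat.eq_dec a l))) with (S n) (remove Nat.eq_dec a l).
  - pose proof (remove_length_lt Nat.eq_dec l a Hal). lia.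
  - trivial.
  - intros b Hb.
    assert (le_fin (f (S (S n))) (f (S n))) as [Hle|(b' & Hb' & HB')].
    { apply Hf. lia. }
    + destruct (Hle b Hb) as [|Hb']; [auto|].
      destruct (H b Hb') as [|Hbl]; [auto|right].
      apply in_in_remove; trivial. now intros ->.
    + destruct (HB _ _ Hb' HB').
Qed.

Theorem mainTheorem7 :
  exists U : upper_presemilattice,
    ei_upper_presemilattice U /\ ~ universal (le U).
Proof.
  exists finset_presemilattice. split; [exact finset_ei|]. intros [_ HU].
  destruct (HU _ ge_ce_preorder) as (f & _ & Hf).
  exact (no_descending_chain f Hf).
Qed.
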